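(* For $Q\geq 0$, \[\frac{d^2}{d\lambda^2}\left(-\sum_{i=Q}^{\infty}\Pr\{\text{Poisson}(\lambda)\leq i\}\right)\] is a positive function of $\lambda\geq 0$.
   Context: $\text{Poisson}(\lambda)$ denotes a Poisson random variable with rate $\lambda$, i.e. $\Pr\{\text{Poisson}(\lambda)=k\}=e^{-\lambda}\lambda^k/k!$ for $k=0,1,2,\ldots$. $Q$ is a fixed order quantity, an integer in $\{0,1,2,\ldots\}$. The statement is used to establish convexity in $\lambda$ of the newsvendor expected cost $G_Q(\lambda)=h(Q-\lambda)+(h+p)\sum_{i=Q}^{\infty}(1-\Pr\{\text{Poisson}(\lambda)\leq i\})$, where $h>0$ is the unit overage cost and $p>0$ the unit underage cost.
   Formalization: The displayed sum diverges, so 1 is added to each term (the term-by-term second derivative is shown to agree); ''positive'' is proved as nonnegative for all Q and λ≥0, and strictly positive for Q≥1, λ>0, since it is 0 for Q=0 and at λ=0 for Q≥2. *)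

(* Defs.v *)
From HB Require Import structures.
From mathcomp Require Import all_boot all_order all_algebra.
From mathcomp Require Import all_classical all_reals all_analysis.

Set Implicit Arguments.
Unset Strict Implicit.
Unset Printing Implicit Defensive.

Import Order.TTheory GRing.Theory Num.Theory.
Import numFieldNormedType.Exports.

Local Open Scope classical_set_scope.
Local Open Scope ring_scope.

(* Derivatives relative to a domain [D], so that at the left endpoint of
   [0, +oo[ the derivative is the right one.  This is needed because
   [poisson_prob] is extended by a Dirac mass to negative rates, so two-sided
   derivatives at rate 0 are not the intended ones. *)
Definition slope_in (R : realType) (f : R -> R) (x y : R) : R :=
  (f y - f x) / (y - x).

Definition derivable_in (R : realType) (D : set R) (f : R -> R) (x : R) :
    Prop :=
  cvg (slope_in f x y @[y --> within D x^']).

Definition derive_in (R : realType) (D : set R) (f : R -> R) (x : R) : R :=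
  lim (slope_in f x y @[y --> within D x^']).

Definition twice_derivable_in (R : realType) (D : set R) (f : R -> R) : Prop :=
  (forall x, D x -> derivable_in D f x) /\
  (forall x, D x -> derivable_in D (derive_in D f) x).

Definition derive2_in (R : realType) (D : set R) (f : R -> R) : R -> R :=
  derive_in D (derive_in D f).

Definition rates (R : realType) : set R := [set x | 0 <= x].

(* Pr{Poisson(lam) <= i}.  The second argument of [poisson_prob] is a dummy:
   its value does not depend on it.  At rate 0 it is the Dirac mass at 0, in
   agreement with the mass function e^-lam lam^k / k! under 0^0 = 1. *)
Definition poisson_cdf (R : realType) (lam : R) (i : nat) : R :=
  fine (poisson_prob lam 0%N [set k : nat | (k <= i)%N]).

(* The series [- \sum_(i >= Q) Pr{Poisson(lam) <= i}] itself diverges to -oo,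
   since its terms tend to -1.  It is meant up to an additive term independent
   of [lam]: adding 1 to each term gives the convergent series
   [\sum_(i >= Q) (1 - Pr{Poisson(lam) <= i})] of the newsvendor cost. *)
Definition loss_partial_sum (R : realType) (Q : nat) (lam : R) (n : nat) : R :=
  \sum_(Q <= i < n) (1 - poisson_cdf lam i).

Definition loss_sum (R : realType) (Q : nat) (lam : R) : R :=
  limn (loss_partial_sum Q lam).

(* Main.v *)
(* Write p_k(x) = e^-x x^k / k! and F_i = p_0 + ... + p_i.  Since
   p_k' = p_(k-1) - p_k, telescoping gives F_i' = - p_i.  The tail sums
   \sum_(i >= 0) (1 - F_i(x)) add up to the mean x, so the loss function is
   x - \sum_(i < Q) (1 - F_i(x)): a finite sum, whose first derivative is
   1 - F_(Q-1) and whose second derivative is p_(Q-1) (0 when Q = 0).  This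
   is also the limit of the telescoping sum of (- F_i)'' = p_(i-1) - p_i.
   Derivatives relative to [0, +oo[ are computed from those of extensions that
   are smooth on the whole line. *)
Require Import Defs.
From HB Require Import structures.
From mathcomp Require Import all_boot all_order all_algebra.
From mathcomp Require Import all_classical all_reals all_analysis.
From mathcomp Require Import ring lra.
Set Implicit Arguments.
Unset Strict Implicit.
Unset Printing Implicit Defensive.
Import Order.TTheory GRing.Theory Num.Theory.
Import numFieldNormedType.Exports.
Local Open Scope classical_set_scope.
Local Open Scope ring_scope.

(** * Derivatives relative to the half-line [0, +oo[ *)

Section one_sided_derivatives.
Variable R : realType.
Implicit Types (f g : R -> R) (x dg : R).

(** Makes limits along this filter unique. The witness [x + e / 2] lies to the right of [x], so it
    also serves at the endpoint 0. *)
Lemma rates_punctured_proper x :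
  0 <= x -> ProperFilter (within (@rates R) x^').
Proof.
move=> x0; apply: Build_ProperFilter_ex => B; rewrite withinE/=.
case=> V /nbhs_ballP[e /= e0 xeV] BV.
have xxe : ball x e (x + e / 2).
  by rewrite /ball/= opprD addNKr normrN gtr0_norm; lra.
have x_neq : x + e / 2 != x by apply/eqP; lra.
exists (x + e / 2).
have : (V `&` @rates R) (x + e / 2).
  by split; [exact: xeV|rewrite /rates/=; lra].
by rewrite -BV => -[].
Qed.

(** With [x] and [y] both in the half-line, the slopes of [f] are those of the extension [g], and
    restricting the filter keeps their limit. *)
Lemma slope_in_cvg f g x dg :
  (forall y : R, 0 <= y -> f y = g y) -> 0 <= x -> is_derive x 1 g dg ->
  slope_in f x y @[y --> within (@rates R) x^'] --> dg.
Proof.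
move=> fg x0 [gx <-].
have slope_g : slope_in g x y @[y --> x^'] --> 'D_1 g x.
  (* Substitution h = y - x; injectivity keeps h away from 0. *)
  have sub_cvg : (y - x) @[y --> x^'] --> (x - x)^'.
    apply: (@continuous_injective_withinNx _ _ (fun y : R => y - x)).
      by apply: cvgB; [exact: cvg_id|exact: cvg_cst].
    by move=> y /addIr.
  rewrite subrr in sub_cvg.
  have gx_cvg : h^-1 *: (g (h *: 1 + x) - g x) @[h --> 0^'] --> 'D_1 g x.
    exact: gx.
  apply: cvg_trans (cvg_comp _ _ sub_cvg gx_cvg).
  apply: near_eq_cvg; near=> y => /=.
  by rewrite /slope_in /= scaler1 subrK mulrC.
apply: cvg_trans (cvg_within_filter (@rates R) slope_g).
by apply: fmap_within_eq => y /set_mem y0; rewrite /slope_in !fg.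
Unshelve. all: by end_near. Qed.

Lemma derive_in_eq f g x dg :
  (forall y : R, 0 <= y -> f y = g y) -> 0 <= x -> is_derive x 1 g dg ->
  derive_in (@rates R) f x = dg.
Proof.
move=> fg x0 gx; have := rates_punctured_proper x0 => ?.
by apply/cvg_lim => //; exact: slope_in_cvg gx.
Qed.

Lemma derivable_in_eq f g x dg :
  (forall y : R, 0 <= y -> f y = g y) -> 0 <= x -> is_derive x 1 g dg ->
  derivable_in (@rates R) f x.
Proof. by move=> fg x0 gx; apply/cvg_ex; exists dg; exact: slope_in_cvg gx. Qed.

(** The first derivative of [f] agrees with [g1] on the half-line, so the first-order lemmas apply a
    second time. *)
Lemma twice_derivable_in_eq f g (g1 g2 : R -> R) :
  (forall y : R, 0 <= y -> f y = g y) ->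
  (forall x : R, is_derive x 1 g (g1 x)) ->
  (forall x : R, is_derive x 1 g1 (g2 x)) ->
  twice_derivable_in (@rates R) f /\
  (forall x, 0 <= x -> derive2_in (@rates R) f x = g2 x).
Proof.
move=> fg g1x g2x.
have f1 y : 0 <= y -> derive_in (@rates R) f y = g1 y.
  by move=> y0; exact: derive_in_eq fg y0 (g1x y).
split; last by move=> x x0; exact: derive_in_eq f1 x0 (g2x x).
split=> x x0; first exact: derivable_in_eq fg x0 (g1x x).
exact: derivable_in_eq f1 x0 (g2x x).
Qed.

End one_sided_derivatives.

(** * Poisson masses, their partial sums and tails *)

Section poisson_mass.
Variable R : realType.
Implicit Types (x : R) (n k i : nat).

(** Given by the same formula at negative [x], so that it is smooth across 0. *)
Definition mass k x : R := exp_coeff x k * expR (- x).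

(** The mass at n - 1, with p_(-1) = 0 so that p_n' = p_(n-1) - p_n also covers n = 0. *)
Definition pred_mass n x : R := if n is k.+1 then mass k x else 0.

(* Pr{Poisson(x) < n}, with a strict inequality. *)
Definition cmass n x : R := \sum_(k < n) mass k x.

Lemma cmassS n x : cmass n.+1 x = cmass n x + mass n x.
Proof. by rewrite /cmass big_ord_recr. Qed.

Lemma cmass0 x : cmass 0 x = 0.
Proof. by rewrite /cmass big_ord0. Qed.

Lemma mass_ge0 k x : 0 <= x -> 0 <= mass k x.
Proof. by move=> x0; rewrite mulr_ge0 ?expR_ge0 ?exp_coeff_ge0. Qed.

Lemma mass_gt0 k x : 0 < x -> 0 < mass k x.
Proof.
by move=> x0; rewrite mulr_gt0 ?expR_gt0 ?divr_gt0 ?exprn_gt0 ?ltr0n ?fact_gt0.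
Qed.

Lemma mass_recr k x : k.+1%:R * mass k.+1 x = x * mass k x.
Proof.
rewrite /mass /exp_coeff /= factS natrM exprS.
have kn0 : (k`!%:R : R) != 0 by rewrite pnatr_eq0 -lt0n fact_gt0.
have k1n0 : (k.+1%:R : R) != 0 by rewrite pnatr_eq0.
by field; rewrite kn0 nat1r k1n0.
Qed.

Lemma is_derive_mass k x :
  is_derive x 1 (mass k) (pred_mass k x - mass k x).
Proof.
have massE : mass k = (k`!%:R^-1 \*: (@id R ^+ k)) * (@expR R \o -%R).
  apply/funext => y; rewrite /mass /exp_coeff !fctE /=.
  by rewrite [y ^+ k / _]mulrC.
rewrite [X in is_derive _ _ X _]massE.
apply: is_derive_eq.
rewrite /mass /exp_coeff /= /GRing.scale /= !exprfctE.
case: k {massE} => [|k] /=; first by rewrite fact0 expr0; ring.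
rewrite /mass /exp_coeff /= factS natrM.
have kn0 : (k`!%:R : R) != 0 by rewrite pnatr_eq0 -lt0n fact_gt0.
have k1n0 : (k.+1%:R : R) != 0 by rewrite pnatr_eq0.
by field; rewrite kn0 nat1r k1n0.
Qed.

Lemma is_derive_cmass n x : is_derive x 1 (cmass n) (- pred_mass n x).
Proof.
elim: n => [|n IHn].
  have -> : cmass 0 = cst 0 by apply/funext => y; exact: cmass0.
  by apply: is_derive_eq; rewrite oppr0.
have -> : cmass n.+1 = cmass n + mass n by apply/funext => y; exact: cmassS.
have dm := is_derive_mass n x.
by apply: is_derive_eq => /=; ring.
Qed.

Lemma poisson_cdfE i x : 0 <= x -> poisson_cdf x i = cmass i.+1 x.
Proof.
rewrite /poisson_cdf /poisson_prob le_eqVlt => /predU1P[<-|x0].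
  (* At rate 0 only the term k = 0 of [cmass] survives, matching the Dirac mass. *)
  rewrite ltxx diracE mem_set//= /cmass big_ord_recl big1 ?addr0.
    by rewrite /mass /exp_coeff /= oppr0 expR0 expr0 fact0 divr1 mulr1.
  by move=> k _; rewrite /mass /exp_coeff /= expr0n !mul0r.
rewrite x0 esum_fset; last 2 first.
- exact: (finite_II i.+1).
- by move=> k _; rewrite lee_fin poisson_pmf_ge0.
rewrite -[[set k | _]]/(`I_i.+1) -fsbig_ord sumEFin /=.
by apply: eq_bigr => k _; rewrite /poisson_pmf x0.
Qed.

Lemma cmass_cvg1 x : cmass n x @[n --> \oo] --> (1 : R).
Proof.
rewrite -(expRxMexpNx_1 x).
have -> : cmass ^~ x = (fun n => series (exp_coeff x) n * expR (- x)).
  by apply/funext => n; rewrite /series /= big_mkord mulr_suml.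
exact: cvgM (is_cvg_series_exp_coeff x) (cvg_cst _).
Qed.

Lemma pred_mass_cvg0 x : pred_mass n x @[n --> \oo] --> (0 : R).
Proof.
have := cvgM (cvg_exp_coeff x) (cvg_cst (expR (- x))).
by rewrite mul0r -(cvg_shiftS (pred_mass ^~ x)); exact.
Qed.

(* Markov-type bound: [k Pr(k) = x Pr(k - 1)] summed over [k > n]. *)
Lemma tail_mass_le n x : 0 <= x ->
  n.+1%:R * (1 - cmass n.+1 x) <= x * (1 - cmass n x).
Proof.
move=> x0.
(* Tails truncated at [m]: each added term uses n + 1 <= m + 1, then [mass_recr]. The claim follows
   as m tends to infinity. *)
have partial m : (n <= m)%N ->
    n.+1%:R * (cmass m.+1 x - cmass n.+1 x) <= x * (cmass m x - cmass n x).
  elim: m => [|m IHm]; first by rewrite leqn0 => /eqP ->; rewrite !subrr !mulr0.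
  rewrite leq_eqVlt => /predU1P[<-|nm]; first by rewrite !subrr !mulr0.
  rewrite [cmass m.+2 x]cmassS [X in _ <= _ * (X - _)]cmassS.
  have := IHm nm.
  have : n.+1%:R * mass m.+1 x <= m.+1%:R * mass m.+1 x.
    by rewrite ler_wpM2r ?mass_ge0// ler_nat.
  by rewrite mass_recr; lra.
have cvg1 := cmass_cvg1 x.
have cvg1S : cmass m.+1 x @[m --> \oo] --> (1 : R).
  by rewrite (cvg_shiftS (cmass ^~ x)).
apply: (ler_cvg_to (cvgM (cvg_cst _) (cvgB cvg1S (cvg_cst _)))
  (cvgM (cvg_cst _) (cvgB cvg1 (cvg_cst _)))).
by exists n => // m /= nm; exact: partial.
Qed.

Lemma cmass_le1 n x : 0 <= x -> cmass n x <= 1.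
Proof.
move=> x0; have cvg1 := cmass_cvg1 x.
rewrite -(cvg_lim _ cvg1)//; apply: nondecreasing_cvgn_le.
  by apply/nondecreasing_seqP => k; rewrite cmassS lerDl mass_ge0.
by apply/cvg_ex; exists 1.
Qed.

(** For x >= 0 both sides are E[min(X, n + 1)] with X of law Poisson(x): the values of X up to n
    contribute x Pr(X < n) by [mass_recr]. *)
Lemma sum_tail_massE n x : \sum_(0 <= i < n.+1) (1 - cmass i.+1 x) =
  n.+1%:R * (1 - cmass n.+1 x) + x * cmass n x.
Proof.
elim: n => [|n IHn].
  by rewrite big_nat1 cmass0 mulr0 addr0 mul1r.
rewrite big_nat_recr//= IHn !cmassS.
have := mass_recr n x; lra.
Qed.

Lemma sum_tail_mass_cvg x : 0 <= x ->
  \sum_(0 <= i < n) (1 - cmass i.+1 x) @[n --> \oo] --> x.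
Proof.
move=> x0.
rewrite -(cvg_shiftS (fun n => \sum_(0 <= i < n) (1 - cmass i.+1 x))).
under eq_fun do rewrite sum_tail_massE.
have tail0 : x * (1 - cmass n x) @[n --> \oo] --> (0 : R).
  have := cvgM (cvg_cst x) (cvgB (cvg_cst (1 : R)) (@cmass_cvg1 x)).
  by rewrite subrr mulr0; exact.
(* The boundary term is squeezed between 0 and x Pr(X >= n). *)
have tailS0 : n.+1%:R * (1 - cmass n.+1 x) @[n --> \oo] --> (0 : R).
  apply: squeeze_cvgr (cvg_cst 0) tail0; near=> n.
  by rewrite tail_mass_le// mulr_ge0// subr_ge0 cmass_le1.
have := cvgD tailS0 (cvgM (cvg_cst x) (@cmass_cvg1 x)).
by rewrite add0r mulr1; exact.
Unshelve. all: by end_near. Qed.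

End poisson_mass.

(** * The loss function in closed form *)

Section loss.
Variables (R : realType) (Q : nat).
Implicit Types x : R.

Definition loss x : R := x - \sum_(i < Q) (1 - cmass i.+1 x).

Lemma loss_partial_sum_cvg x : 0 <= x ->
  loss_partial_sum Q x n @[n --> \oo] --> loss x.
Proof.
move=> x0; rewrite /loss -(big_mkord xpredT (fun i => 1 - cmass i.+1 x)).
apply: cvg_trans (cvgB (sum_tail_mass_cvg x0) (cvg_cst _)).
(* Once n >= Q, removing the first Q tails from the full sum leaves the partial sum from Q. *)
apply: near_eq_cvg; exists Q => // n /= Qn.
rewrite /loss_partial_sum !fctE (big_cat_nat (leq0n Q) Qn)/=.
rewrite addrAC subrr add0r.
by apply: eq_bigr => i _; rewrite poisson_cdfE.
Qed.

Lemma loss_sumE x : 0 <= x -> loss_sum Q x = loss x.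
Proof. by move=> x0; apply/cvg_lim => //; exact: loss_partial_sum_cvg. Qed.

Lemma is_derive_loss x : is_derive x 1 loss (1 - cmass Q x).
Proof.
have -> : loss = id - \sum_(i < Q) (cst 1 - @cmass R i.+1).
  by apply/funext => y; rewrite /loss !fctE fct_sumE.
have dc i := is_derive_cmass i x.
apply: is_derive_eq; congr (_ - _).
by apply: eq_bigr => i _; rewrite sub0r opprK.
Qed.

Lemma is_derive2_loss x :
  is_derive x 1 (fun y => 1 - cmass Q y) (pred_mass Q x).
Proof.
rewrite (_ : (fun y => _) = cst 1 - @cmass R Q)//.
have dc := is_derive_cmass Q x.
by apply: is_derive_eq; rewrite sub0r opprK.
Qed.

End loss.

Theorem theorem4 (R : realType) (Q : nat) :
  (* the sum is a well-defined, twice differentiable function of lam >= 0 *)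
  (forall lam : R, 0 <= lam -> cvgn (loss_partial_sum Q lam)) /\
  twice_derivable_in (@rates R) (loss_sum Q) /\
  (* its second derivative is that of - \sum_(i >= Q) Pr{Poisson(lam) <= i},
     differentiated term by term *)
  (forall i : nat,
    twice_derivable_in (@rates R) (fun lam : R => - poisson_cdf lam i)) /\
  (forall lam : R, 0 <= lam ->
    (\sum_(Q <= i < n)
        derive2_in (@rates R) (fun l : R => - poisson_cdf l i) lam)
      @[n --> \oo] --> derive2_in (@rates R) (loss_sum Q) lam) /\
  (* positivity: >= 0 throughout, and > 0 for Q >= 1 and lam > 0 *)
  (forall lam : R, 0 <= lam ->
    0 <= derive2_in (@rates R) (loss_sum Q) lam) /\
  (forall lam : R, (0 < Q)%N -> 0 < lam ->
    0 < derive2_in (@rates R) (loss_sum Q) lam).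
Proof.
have [loss_diff loss_d2] := twice_derivable_in_eq (@loss_sumE R Q)
  (@is_derive_loss R Q) (@is_derive2_loss R Q).
have cdf_d2 i :
    twice_derivable_in (@rates R) (fun l : R => - poisson_cdf l i) /\
    (forall x : R, 0 <= x ->
      derive2_in (@rates R) (fun l : R => - poisson_cdf l i) x =
      pred_mass i x - mass i x).
  apply: (@twice_derivable_in_eq _ _ (- @cmass R i.+1) (@mass R i)).
  - by move=> y y0; rewrite poisson_cdfE.
  - move=> x; have dc := is_derive_cmass i.+1 x.
    by apply: is_derive_eq; rewrite opprK.
  - exact: is_derive_mass.
split.
  by move=> x x0; apply/cvg_ex; exists (loss Q x); exact: loss_partial_sum_cvg.
split=> //; split; first by move=> i; case: (cdf_d2 i).
split.
  move=> x x0; rewrite loss_d2//.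
  have := cvgB (cvg_cst (pred_mass Q x)) (@pred_mass_cvg0 R x).
  rewrite subr0 => /(_ _ _) diff_cvg; apply: cvg_trans diff_cvg.
  apply: near_eq_cvg; exists Q => // n /= Qn.
  (* Since [pred_mass i.+1] is [mass i], the finite sum telescopes to
     [pred_mass Q x - pred_mass n x]. *)
  rewrite !fctE -opprB -(telescope_sumr (fun i => pred_mass i x) Qn) -sumrN.
  apply: eq_bigr => i _; case: (cdf_d2 i) => _ ->//.
  by rewrite opprB.
(* The second derivative is 0 for Q = 0 and [mass k] for Q = k + 1. *)
split=> [x x0|x Q0 x0].
  by rewrite loss_d2//; case: (Q) => //= k; exact: mass_ge0.
by rewrite loss_d2 ?ltW//; case: (Q) Q0 => //= k _; exact: mass_gt0.
Qed.
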